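(* As $x$ ranges over all points of $\mathbb R^2$, the possible classifiers $(G_x,c_x)$ of $\mathcal G_2$-orbits are as follows. (i) If $\operatorname{rank}(G_x)\in\{1,3\}$, then $c_x=1$. (ii) If $\operatorname{rank}(G_x)=2$, let $d$ be the denominator of the smallest positive nonzero rational element of $G_x$. If $d\leq 4$, then $c_x=1$. If $d\geq 5$, then any integer $c$ relatively prime with $d$ and such that $0<c<d/2$ may occur: there is $x'\in\mathbb R^2$ with $G_{x'}=G_x$ and $c_{x'}=c$. Thus precisely $\max(1,\phi(d)/2)$ distinct orbits are classified by the same group $G_x$, i.e., the set $\{y\in\mathbb R^2\mid G_y=G_x\}$ is the union of precisely $\max(1,\phi(d)/2)$ distinct orbits. (iii) No other pair $(G_x,c_x)$ may occur; that is, if $\operatorname{rank}(G_x)=2$ and $d\geq5$, then $c_x$ is relatively prime with $d$ and $0<c_x<d/2$.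
   Context: Orbits: $\mathcal G_2=GL(2,\mathbb Z)\ltimes\mathbb Z^2$ is the group of affine transformations of $\mathbb R^2$ of the form $x\mapsto Ux+t$, with $t\in\mathbb Z^2$ and $U$ an integer $2\times2$ matrix with $\det(U)=\pm1$; orbit means $\mathcal G_2$-orbit. For $x=(x_1,x_2)\in\mathbb R^2$, $G_x=\mathbb Z+\mathbb Zx_1+\mathbb Zx_2\subseteq\mathbb R$, and $\operatorname{rank}(G_x)$ is its rank as a free abelian group. $\phi$ is Euler's function. Regular simplexes: a point $y\in\mathbb R^n$ is rational if all its coordinates are rational; its denominator $\operatorname{den}(y)$ is the least common denominator of its coordinates; its homogeneous correspondent is $\tilde y=\operatorname{den}(y)\,(y,1)\in\mathbb Z^{n+1}$. A simplex $\operatorname{conv}(v_0,\ldots,v_k)\subseteq\mathbb R^n$ with rational vertices is regular if $\{\tilde v_0,\ldots,\tilde v_k\}$ can be extended to a basis of the free abelian group $\mathbb Z^{n+1}$. The integer $c_x$: a rational hyperplane in $\mathbb R^n$ is a set $\{z\in\mathbb R^n\mid h\cdot z=k\}$ with $0\neq h\in\mathbb Q^n$, $k\in\mathbb Q$; a rational affine space is an intersection of rational hyperplanes ($\mathbb R^n$ itself being the empty intersection). For $x\in\mathbb R^n$, $F_x$ is the intersection of all rational hyperplanes of $\mathbb R^n$ containing $x$ (with $F_x=\mathbb R^n$ if there are none). For an $e$-dimensional rational affine space $F\subseteq\mathbb R^n$ ($0\le e\le n$), $c_F$ is the smallest possible denominator of a vertex of a regular $n$-simplex $\operatorname{conv}(v_0,\ldots,v_n)\subseteq\mathbb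 R^n$ with $v_0,\ldots,v_e\in F$ (the minimum is over all such simplexes and all of their vertices). Put $c_x=c_{F_x}$. Here $n=2$. *)

(* Defs.v *)
From HB Require Import structures.
From mathcomp Require Import all_boot all_order all_algebra.
From mathcomp Require Import all_classical all_reals.

Set Implicit Arguments.
Unset Strict Implicit.
Unset Printing Implicit Defensive.

Import Order.TTheory GRing.Theory Num.Theory.

Local Open Scope classical_set_scope.
Local Open Scope ring_scope.

(* Points of the n-dimensional space over K are column vectors, so that an
   affine map reads x |-> U *m x + t.  Rational points are elements of
   'cV[rat]_n, embedded in 'cV[R]_n by ratr. *)

Section FreeAbelianGroups.
Variable V : zmodType.

Definition Zbasis (A : set V) (r : nat) (b : 'I_r -> V) : Prop :=
  (forall v, A v <-> exists c : 'I_r -> int, v = \sum_i b i *~ c i) /\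
  (forall c : 'I_r -> int, \sum_i b i *~ c i = 0 -> forall i, c i = 0).

Definition Zrank (A : set V) : nat :=
  xget 0%N [set r | exists b : 'I_r -> V, Zbasis A b].

End FreeAbelianGroups.

Section RegularSimplexes.
Variable n : nat.

Definition den (y : 'cV[rat]_n) : nat :=
  \big[lcmn/1%N]_(j < n) `|denq (y j 0%R)|%N.

(* The entries of den y *: (y, 1) are integers: numq only changes their type. *)
Definition homog (y : 'cV[rat]_n) : 'cV[int]_(n + 1) :=
  map_mx numq ((den y)%:R *: col_mx y (const_mx 1)).

(* Affine independence of the v i follows from the linear independence of
   the homog (v i). *)
Definition regular_simplex k (v : 'I_k.+1 -> 'cV[rat]_n) : Prop :=
  exists b : 'I_(n + 1) -> 'cV[int]_(n + 1),
    Zbasis [set: 'cV[int]_(n + 1)] b /\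
    exists2 f : 'I_k.+1 -> 'I_(n + 1),
      injective f & forall i, b (f i) = homog (v i).

End RegularSimplexes.

Section RationalAffineSpaces.
Variables (R : realType) (n : nat).

Definition rational_hyperplane (H : set 'cV[R]_n) : Prop :=
  exists (h : 'cV[rat]_n) (k : rat),
    h != 0 /\ H = [set z | \sum_j ratr (h j 0) * z j 0 = ratr k].

Definition Fx (x : 'cV[R]_n) : set 'cV[R]_n :=
  \bigcap_(H in [set H | rational_hyperplane H /\ H x]) H.

Definition has_dim (F : set 'cV[R]_n) (e : nat) : Prop :=
  exists (p : 'cV[R]_n) (B : 'M[R]_(n, e)),
    \rank B = e /\ F = [set p + B *m u | u in [set: 'cV[R]_e]].

Definition vertex_dens (F : set 'cV[R]_n) : set nat :=
  [set m | exists (e : nat) (v : 'I_n.+1 -> 'cV[rat]_n),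
    [/\ has_dim F e,
        regular_simplex v,
        forall i : 'I_n.+1, (i <= e)%N -> F (map_mx ratr (v i))
      & exists i, m = den (v i)]].

Definition cF (F : set 'cV[R]_n) : nat :=
  xget 0%N [set m | vertex_dens F m /\
                    forall m', vertex_dens F m' -> (m <= m')%N].

Definition cx (x : 'cV[R]_n) : nat := cF (Fx x).

End RationalAffineSpaces.

Section Plane.
Variable R : realType.

Definition Gx (x : 'cV[R]_2) : set R :=
  [set z | exists a b c : int, z = a%:~R + b%:~R * x 0 0 + c%:~R * x 1 0].

Definition G2orbit (x : 'cV[R]_2) : set 'cV[R]_2 :=
  [set y | exists (U : 'M[int]_2) (t : 'cV[int]_2),
    (\det U = 1 \/ \det U = -1) /\
    y = map_mx intr U *m x + map_mx intr t].

Definition least_pos_rat (A : set R) (q : rat) : Prop :=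
  [/\ 0 < q, A (ratr q) & forall q' : rat, 0 < q' -> A (ratr q') -> q <= q'].

Definition union_of_orbits (N : nat) (S : set 'cV[R]_2) : Prop :=
  exists O : 'I_N -> set 'cV[R]_2,
    [/\ injective O,
        forall i, exists y, O i = G2orbit y
      & S = \bigcup_i O i].

End Plane.

(* Main.v *)
Require Import Defs.
From HB Require Import structures.
From mathcomp Require Import all_boot all_order all_algebra.
From mathcomp Require Import all_classical all_reals.
From mathcomp Require Import ring lra zify.

Set Implicit Arguments.
Unset Strict Implicit.
Unset Printing Implicit Defensive.

Import Order.TTheory GRing.Theory Num.Theory.

Local Open Scope classical_set_scope.
Local Open Scope ring_scope.

(** When rank(G_x) = 1 the point x is rational, so F_x = {x}; a primitive
    integer vector over x extends to a basis of Z^3 having a second vector with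
    last coordinate 1 ([cx_rational]).  When rank(G_x) = 3 no rational line
    passes through x, so F_x is the plane, which contains the standard triangle
    ([cx_generic]).  Both give c_x = 1.

    When rank(G_x) = 2 the point lies on exactly one rational line h.z = r,
    with h a primitive integer vector.  Completing h to a unimodular matrix
    carries x to a point (a, r) with a irrational ([normal_form_exists],
    [normal_form_orbit]).  Writing r = p / d in lowest terms,
    G_x = Z a + Z (1/d), so that 1/d is the least positive rational of G_x.

    The integer c_x is read off the functional
    L(y, m) = d (h.y) - p m on Z^3.  It is onto, and among the homogeneous
    vectors of rational points it vanishes on those of the points of F_x.  In a regular triangle with two vertices on F_x
    the first two basis vectors lie in ker L, hence L takes the value 1 or -1 on
    the third one: its denominator m satisfies p m = 1 or -1 modulo d.  The
    denominators of the vertices on F_x are multiples of d.  Conversely every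
    m > 0 with p m = 1 or -1 modulo d is reached, so c_x is the smallest such m
    ([cx_line]).  Therefore c_x is prime to d, and either c_x = 1 or c_x < d/2;
    and each c allowed by these constraints is obtained by taking for p an
    inverse of c modulo d.

    Two points (a, p/d) and (a', p'/d) with the same group satisfy
    a' = a + j/d or a' = - a + j/d.  As p is invertible modulo d, a shear
    along the first axis followed by a translation absorbs j/d, so the points
    are in the same orbit as soon as p' = p or - p modulo d ([G2orbit_pt]).
    Irrationality of a makes this condition necessary ([G2orbit_pt_num]).  The
    orbits with a given group thus correspond to the units modulo d up to sign,
    of which there are max(1, phi(d)/2) ([size_sign_reps]). *)

(** * Regular simplexes from unimodular matrices *)

Lemma Zbasis_mx m (M : 'M[int]_m) :
  M \in unitmx -> Zbasis [set: 'cV[int]_m] (fun i => col i M).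
Proof.
move=> uM.
have colsum (c : 'I_m -> int) : \sum_i col i M *~ c i = M *m (\col_i c i).
  apply/colP => j; rewrite summxE mxE; apply: eq_bigr => i _.
  by rewrite -scaler_int !mxE mulrC intz.
split=> [v|c].
  split=> [_|_]; last by [].
  exists (fun i => (invmx M *m v) i 0).
  rewrite colsum -[LHS](mulKVmx uM); congr (_ *m _).
  by apply/colP => i; rewrite [RHS]mxE.
rewrite colsum => Mc0 i.
have := congr1 (fun w => (invmx M *m w) i 0) Mc0.
by rewrite /= mulKmx // mulmx0 !mxE.
Qed.

Lemma den_gt0 n (y : 'cV[rat]_n) : (0 < den y)%N.
Proof.
rewrite /den; elim/big_ind: _ => // [a b a0 b0|j _]; first by rewrite lcmn_gt0 a0.
by rewrite absz_gt0 denq_neq0.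
Qed.

Lemma den_dvd n (y : 'cV[rat]_n) (m : nat) :
  (forall j, exists a : int, m%:R * y j 0 = a%:~R) -> (den y %| m)%N.
Proof.
move=> int_y; apply/dvdn_biglcmP => j _.
have [a Da] := int_y j.
have /(Gauss_dvdl m) <- : coprime `|denq (y j 0%R)| `|numq (y j 0%R)|.
  by rewrite coprime_sym coprime_num_den.
suff -> : (m * `|numq (y j 0%R)| = `|a| * `|denq (y j 0%R)|)%N by rewrite dvdn_mull.
have: m%:Z * numq (y j 0%R) = a * denq (y j 0%R).
  by apply: (@intr_inj rat); rewrite !rmorphM /= numqE mulrA Da.
by move/(congr1 absz); rewrite !abszM.
Qed.

Lemma homog_val n (y : 'cV[rat]_n) (j : 'I_n) :
  (homog y (lshift 1 j) 0)%:~R = (den y)%:R * y j 0.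
Proof.
rewrite /homog mxE mxE col_mxEu.
have [k Dk] : exists k : nat, den y = (k * `|denq (y j 0%R)|)%N.
  by apply/dvdnP; rewrite /den (biglcmn_sup j).
suff -> : (den y)%:R * y j 0 = (k%:Z * numq (y j 0))%:~R by rewrite numq_int.
rewrite Dk natrM natr_absz gtr0_norm ?denq_gt0 //.
by rewrite intrM numqE -mulrA [y j 0 * _]mulrC.
Qed.

Lemma homog_last n (y : 'cV[rat]_n) j : homog y (rshift n j) 0 = den y.
Proof. by rewrite /homog mxE mxE col_mxEd mxE mulr1 pmulrn numq_int. Qed.

(** This inverts [homog] on the primitive vectors with positive last entry. *)
Definition dehom n (w : 'cV[int]_(n + 1)) : 'cV[rat]_n :=
  \col_j ((w (lshift 1 j) 0)%:~R / (w (rshift n 0) 0)%:~R).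

(** The row g witnesses that w is primitive.  The denominator D of [dehom w]
    makes every entry of D w divisible by m, hence also
    g (D w) = D. *)
Lemma den_dehom n (w : 'cV[int]_(n + 1)) (g : 'rV[int]_(n + 1)) (m : nat) :
  g *m w = 1 -> w (rshift n 0) 0 = m -> (0 < m)%N -> den (dehom w) = m.
Proof.
move=> gw wm m0; apply/eqP; rewrite eqn_dvd; apply/andP; split.
  apply: den_dvd => j; exists (w (lshift 1 j) 0).
  by rewrite mxE wm mulrC divfK // intr_eq0; case: (m) m0.
have dvdw i : (m%:Z %| (den (dehom w))%:Z * w i 0%R)%Z.
  case: (split_ordP i) => j ->; last by rewrite ord1 wm dvdz_mull.
  apply/dvdzP; exists (homog (dehom w) (lshift 1 j) 0).
  apply: (@intr_inj rat); rewrite !rmorphM /= homog_val mxE wm -mulrA divfK //.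
  by rewrite intr_eq0; case: (m) m0.
suff : (m%:Z %| (den (dehom w))%:Z)%Z by [].
rewrite -[X in (_ %| X)%Z]mulr1.
have -> : 1%R = (\sum_i g 0 i * w i 0)%R :> int.
  by move/matrixP: gw => /(_ 0 0); rewrite !mxE => ->.
rewrite mulr_sumr.
elim/big_ind: _ => // [a b da db|i _]; first by rewrite rpredD.
by rewrite mulrCA dvdz_mull.
Qed.

Lemma homog_dehom n (w : 'cV[int]_(n + 1)) (g : 'rV[int]_(n + 1)) :
  g *m w = 1 -> 0 < w (rshift n 0) 0 -> homog (dehom w) = w.
Proof.
move=> gw w0; case Dm: (w (rshift n 0) 0) w0 => [m|] // m0.
have dm := den_dehom gw Dm m0.
apply/colP => i; case: (split_ordP i) => j ->.
  apply: (@intr_inj rat); rewrite homog_val mxE dm Dm mulrC divfK //.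
  by rewrite intr_eq0; case: (m) m0.
by rewrite homog_last dm ord1 Dm.
Qed.

(** The rows of the inverse of M are the witnesses that its columns are
    primitive. *)
Lemma regular_simplex_mx n (M : 'M[int]_(n + 1)) :
    M \in unitmx -> (forall i, 0 < M (rshift n 0) i) ->
  forall f : 'I_n.+1 -> 'I_(n + 1), injective f ->
  regular_simplex (fun i => dehom (col (f i) M)) /\
  forall i, ((den (dehom (col (f i) M)))%:Z = M (rshift n 0) (f i)).
Proof.
move=> uM M0 f injf.
have gw i : row i (invmx M) *m col i M = 1.
  apply/matrixP => j k; rewrite !ord1.
  transitivity ((invmx M *m M) i i); last by rewrite mulVmx // !mxE eqxx.
  by rewrite !mxE; apply: eq_bigr => l _; rewrite !mxE.
have lastE i : col i M (rshift n 0) 0 = M (rshift n 0) i by rewrite mxE.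
split.
  exists (fun i => col i M); split; first exact: Zbasis_mx.
  by exists f => // i; rewrite (homog_dehom (gw _)) // lastE.
by move=> i; rewrite -(homog_last _ 0) (homog_dehom (gw _)) // lastE.
Qed.

(** * Triangles in the plane *)

Definition pt T (a b : T) : 'cV[T]_2 := \col_j (if j == 0 then a else b).

Lemma ptE T (a b : T) : (pt a b 0 0 = a) * (pt a b 1 0 = b).
Proof. by rewrite !mxE. Qed.

Lemma ptP T (y z : 'cV[T]_2) : y 0 0 = z 0 0 -> y 1 0 = z 1 0 -> y = z.
Proof.
move=> e0 e1; apply/colP; case=> [[|[|//]] lt_j2].
  by rewrite (_ : Ordinal lt_j2 = 0) //; apply: val_inj.
by rewrite (_ : Ordinal lt_j2 = 1) //; apply: val_inj.
Qed.

Lemma sum2E (V : zmodType) (F : 'I_2 -> V) : \sum_i F i = F 0 + F 1.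
Proof.
rewrite !big_ord_recl big_ord0 addr0; congr (_ + F _).
exact: val_inj.
Qed.

Lemma det_mx2 (K : comPzRingType) (A : 'M[K]_2) :
  \det A = A 0 0 * A 1 1 - A 0 1 * A 1 0.
Proof.
rewrite (expand_det_row A 0) sum2E /cofactor !det_mx11 !mxE /=.
have -> : lift (0 : 'I_2) (0 : 'I_1) = 1 by apply: val_inj.
have -> : lift (1 : 'I_2) (0 : 'I_1) = 0 by apply: val_inj.
by rewrite expr0 expr1 mul1r mulN1r mulrN.
Qed.

Definition tri T (a b c : T) (i : 'I_3) : T := nth c [:: a; b] i.

Lemma det_mx3 (K : comPzRingType) (a0 b0 c0 a1 b1 c1 a2 b2 c2 : K) :
  \det (\matrix_(j < 3, i < 3)
    tri (tri a0 a1 a2 i) (tri b0 b1 b2 i) (tri c0 c1 c2 i) j) =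
  a0 * (b1 * c2 - b2 * c1) - a1 * (b0 * c2 - b2 * c0)
    + a2 * (b0 * c1 - b1 * c0).
Proof.
rewrite (expand_det_row _ ord0) !big_ord_recl !big_ord0 /cofactor !det_mx2.
rewrite !mxE /tri /= /bump /= !addn0 !addn1 /= !expr0 expr1 expr2.
by ring.
Qed.

Lemma regular_triangle (a0 b0 m0 a1 b1 m1 a2 b2 m2 : int) :
    a0 * (b1 * m2 - b2 * m1) - a1 * (b0 * m2 - b2 * m0)
      + a2 * (b0 * m1 - b1 * m0) \is a GRing.unit ->
    0 < m0 -> 0 < m1 -> 0 < m2 ->
  let v i := pt ((tri a0 a1 a2 i)%:~R / (tri m0 m1 m2 i)%:~R : rat)
                ((tri b0 b1 b2 i)%:~R / (tri m0 m1 m2 i)%:~R) in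
  regular_simplex v /\ forall i, (den (v i))%:Z = tri m0 m1 m2 i.
Proof.
rewrite -det_mx3; set M := \matrix_(j, i) _ => uM m0_gt0 m1_gt0 m2_gt0 v.
have M0 i : 0 < M (rshift 2 0) i by rewrite mxE; case: i => [[|[|[|//]]] ?].
have [rs dens] := @regular_simplex_mx 2 M uM M0 id (@inj_id _).
have vE : v = (fun i => @dehom 2 (col i M)).
  by apply/funext=> i; apply: ptP; rewrite !mxE.
by split=> [|i]; rewrite vE // dens mxE.
Qed.

(** * Arithmetic of integers and rationals *)

Lemma primitive_direction (r s : rat) : exists (t : rat) (h1 h2 u v : int),
  [/\ r = t * h1%:~R, s = t * h2%:~R & u * h1 + v * h2 = 1].
Proof.
set a := numq r * denq s; set b := numq s * denq r.
set D : rat := (denq r)%:~R * (denq s)%:~R.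
have Dr : r = a%:~R / D.
  by rewrite /a /D intrM numqE; field; rewrite !intr_eq0 !denq_neq0.
have Ds : s = b%:~R / D.
  by rewrite /b /D intrM numqE; field; rewrite !intr_eq0 !denq_neq0.
have [g0|gn0] := eqVneq (gcdz a b) 0.
  move: g0 => /eqP; rewrite gcdz_eq0 => /andP[/eqP a0 /eqP b0].
  (* For r = s = 0 any primitive vector will do. *)
  by exists 0, 1, 0, 1, 0; rewrite Dr Ds a0 b0 !mul0r; split.
have [u [v uv]] := Bezoutz a b.
exists ((gcdz a b)%:~R / D), (a %/ gcdz a b)%Z, (b %/ gcdz a b)%Z, u, v.
have Da := divzK (dvdz_gcdl a b); have Db := divzK (dvdz_gcdr a b).
split; first by rewrite mulrAC -intrM mulrC [gcdz a b * _]mulrC Da mulrC.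
  by rewrite mulrAC -intrM mulrC [gcdz a b * _]mulrC Db mulrC.
apply: (mulIf gn0); rewrite mulrDl -!mulrA Da Db mul1r.
exact: uv.
Qed.

Lemma bezout_pos (g m : int) : coprimez g m -> 0 < m ->
  exists q s : int, 0 < q /\ g * q - m * s = 1.
Proof.
move=> /eqP cgm m_gt0; have [u [v]] := Bezoutz g m.
(* Moving along the solutions by |u| + 1 steps makes the first one positive. *)
rewrite cgm => uv; exists (u + (`|u| + 1) * m), ((`|u| + 1) * g - v); split.
  by have := ler_norm (- u); rewrite normrN => ?; nia.
by rewrite -[RHS]uv; ring.
Qed.

Lemma dvdz_le_norm (d z : int) : (d %| z)%Z -> z != 0 -> d <= `|z|.
Proof. by rewrite -absz_gt0 => /[swap] z0 /(dvdn_leq z0); lia. Qed.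

Lemma denq_inv (d : int) : 0 < d -> denq d%:~R^-1 = d.
Proof.
move=> d0; rewrite -[_^-1]mul1r -[1]/(1%:~R) coprimeq_den ?coprime1n //.
by rewrite gt_eqF // gtr0_norm.
Qed.

Lemma coprime_subl k d : (k <= d)%N -> coprime (d - k) d = coprime k d.
Proof.
move=> kd; have [j Dj] : exists j, d = (k + j)%N by exists (d - k)%N; lia.
by rewrite Dj addKn /coprime gcdnDl [(k + j)%N]addnC gcdnDl gcdnC.
Qed.

(** Take the smaller of the residues of z and - z modulo d. *)
Lemma sign_rep (d z : int) : 0 < d -> coprimez d z ->
  exists k : nat, [/\ coprime k `|d|, 2 * k%:Z <= d
    & (d %| z - k%:Z)%Z \/ (d %| z + k%:Z)%Z].
Proof.
move=> d0 cdz.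
have [k Dk] : exists k : nat, (z %% d)%Z = k%:Z.
  by exists `|(z %% d)%Z|%N; rewrite gez0_abs // modz_ge0 // gt_eqF.
have kd : k%:Z < d by rewrite -Dk ltz_pmod.
have zk : (d %| z - k%:Z)%Z.
  by rewrite -Dk {1}(divz_eq z d) addrK dvdz_mull.
have ckd : coprime k `|d|.
  rewrite coprime_sym -[coprime _ _]/(coprimez d k%:Z) -Dk.
  by rewrite /coprimez gcdz_modr.
have [le_kd|lt_dk] := lerP (2 * k%:Z) d; first by exists k; split=> //; left.
exists (`|d| - k)%N; split.
- by rewrite coprime_subl; [exact: ckd | lia].
- lia.
- right; rewrite (_ : _ + _ = z - k%:Z + d); last by lia.
  by rewrite rpredD.
Qed.

(** The bound is not strict, and 0 is allowed, so as to have one representative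
    also for d = 2 and for d = 1. *)
Definition sign_reps (d : nat) : seq nat :=
  [seq k <- iota 0 d | coprime k d && (2 * k <= d)%N].

(** For d > 2 no representative is 0 or d/2, so k |-> d - k is a bijection from
    the representatives onto the other units modulo d. *)
Lemma size_sign_reps d :
  (0 < d)%N -> size (sign_reps d) = maxn 1 (totient d)./2.
Proof.
move=> d0; have [|d2] := leqP d 2; first by case: d d0 => [|[|[|]]].
suff Dt : totient d = (size (sign_reps d)).*2.
  by move: (totient_gt0 d); rewrite Dt doubleK d0; lia.
pose high := [seq k <- iota 0 d | coprime k d && ~~ (2 * k <= d)%N].
have -> : totient d = (size (sign_reps d) + size high)%N.
  rewrite totient_count_coprime /sign_reps /high !size_filter.
  rewrite /index_iota subn0 -sum1_count -[X in (_ + X)%N]sum1_count.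
  rewrite [X in (X + _)%N]big_mkcond [X in (_ + X)%N]big_mkcond -big_split /=.
  apply: eq_bigr => k _; rewrite coprime_sym.
  by case: (coprime k d); case: (2 * k <= d)%N.
suff /perm_size -> : perm_eq high [seq (d - k)%N | k <- sign_reps d].
  by rewrite size_map addnn.
have repP k : k \in sign_reps d -> [/\ (0 < k)%N, (2 * k < d)%N & coprime k d].
  rewrite mem_filter mem_iota => /andP[/andP[ckd le_kd] _].
  have k0 : (0 < k)%N.
    by case: k ckd {le_kd} => //; rewrite /coprime gcd0n => /eqP; lia.
  split=> //; rewrite ltn_neqAle le_kd andbT; apply/eqP => Dd.
  by move: ckd; rewrite -Dd coprimeMr => /andP[_]; rewrite /coprime gcdnn; lia.
apply: uniq_perm.
- by rewrite filter_uniq ?iota_uniq.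
- rewrite map_inj_in_uniq ?filter_uniq ?iota_uniq // => k l /repP[? ? _] /repP[? ? _].
  lia.
move=> k; apply/idP/mapP => [|[l /repP[l0 ld cld] ->]].
  rewrite mem_filter mem_iota => /andP[/andP[ckd lt_dk] /= kd].
  exists (d - k)%N; last by lia.
  by rewrite mem_filter mem_iota coprime_subl ?ckd; lia.
by rewrite mem_filter mem_iota coprime_subl ?cld; lia.
Qed.

(** * Generators and bases of abelian groups *)

Lemma Zbasis_mem (V : zmodType) (A : set V) r (b : 'I_r -> V) i :
  Zbasis A b -> A (b i).
Proof.
move=> [bP _]; apply/bP; exists (fun j => (j == i)%:Z).
by rewrite (bigD1 i) //= eqxx mulr1z big1 ?addr0 // => j /negPf ->.
Qed.

Lemma Zrank_basis (V : zmodType) (A : set V) r :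
  Zrank A = r.+1 -> exists b : 'I_r.+1 -> V, Zbasis A b.
Proof. by rewrite /Zrank; case: xgetP => // s _ /[swap] ->. Qed.

Lemma sumMz (V : zmodType) m n (b : 'I_m -> V) (M : 'M[int]_(m, n))
    (c : 'I_n -> int) :
  \sum_i b i *~ (\sum_l M i l * c l) = \sum_l (\sum_i b i *~ M i l) *~ c l.
Proof.
under eq_bigr do rewrite mulrz_sumr.
rewrite exchange_big; apply: eq_bigr => l _; rewrite mulrz_suml.
by apply: eq_bigr => i _; rewrite mulrzA.
Qed.

(** Expressing g through b and b through g gives integer matrices M and N with
    M N = 1, because b is free.  They are square, so N M = 1 as well, and a
    relation c between the elements of g, which satisfies M c = 0, vanishes. *)
Lemma generators_free (V : zmodType) (A : set V) n (g b : 'I_n -> V) :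
    (forall v, A v <-> exists c : 'I_n -> int, v = \sum_i g i *~ c i) ->
    Zbasis A b ->
  forall c : 'I_n -> int, \sum_i g i *~ c i = 0 -> forall i, c i = 0.
Proof.
move=> gP bA; have [bP bfree] := bA.
have gA j : A (g j).
  apply/gP; exists (fun l => (l == j)%:Z).
  by rewrite (bigD1 j) //= eqxx mulr1z big1 ?addr0 // => l /negPf ->.
have [M DM] : exists M : 'M[int]_n, forall i, g i = \sum_j b j *~ M j i.
  have /choice[m Dm] : forall i, exists m : 'I_n -> int, g i = \sum_j b j *~ m j.
    by move=> l; apply/bP/gA.
  exists (\matrix_(j, i) m i j) => l; rewrite Dm; apply: eq_bigr => j _.
  by rewrite mxE.
have [N DN] : exists N : 'M[int]_n, forall j, b j = \sum_i g i *~ N i j.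
  have /choice[m Dm] : forall j, exists m : 'I_n -> int, b j = \sum_i g i *~ m i.
    by move=> j; apply/gP; apply: Zbasis_mem bA.
  exists (\matrix_(i, j) m j i) => j; rewrite Dm; apply: eq_bigr => l _.
  by rewrite mxE.
have MN : M *m N = 1%:M.
  apply/matrixP => i j; apply/eqP; rewrite -subr_eq0; apply/eqP; move: i.
  apply: (bfree (fun i => (M *m N) i j - 1%:M i j)).
  under eq_bigr do rewrite mulrzBr mxE.
  rewrite sumrB sumMz [X in _ - X](bigD1 j) //= mxE eqxx mulr1z.
  rewrite [X in _ - (_ + X)]big1 => [|i /negPf ij]; last by rewrite mxE ij.
  by rewrite addr0 [X in _ - X]DN; under eq_bigr do rewrite -DM; rewrite subrr.
move=> c gc0 i; have Mc0 j : \sum_l M j l * c l = 0.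
  move: j; apply: (bfree (fun j => \sum_l M j l * c l)).
  by rewrite sumMz; under eq_bigr do rewrite -DM.
transitivity ((N *m (M *m \col_l c l)) i 0).
  by rewrite mulmxA (mulmx1C MN) mul1mx mxE.
rewrite mxE big1 // => j _; rewrite [X in _ * X](_ : _ = 0) ?mulr0 //.
by rewrite -[RHS](Mc0 j) mxE; apply: eq_bigr => l' _; rewrite mxE.
Qed.

Section Points.
Variable R : realType.
Implicit Types x y z : 'cV[R]_2.

(** * The space F_x and the integer c_x for a rational or a generic point *)

(** The zero normal vector can be allowed: its equation is 0 = k. *)
Lemma FxP x z : Fx x z <-> forall a b k : rat,
  ratr a * x 0 0 + ratr b * x 1 0 = ratr k ->
  ratr a * z 0 0 + ratr b * z 1 0 = ratr k.
Proof.
split=> [Fz a b k xk | zP H [[h [k [_ ->]]]]]; last first.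
  by rewrite /= !sum2E; apply: zP.
have [/eqP h0|h0] := boolP (pt a b == 0).
  have a0 : a = 0 by rewrite -[a](ptE a b) h0 mxE.
  have b0 : b = 0 by rewrite -[b](ptE a b) h0 mxE.
  by move: xk; rewrite a0 b0 rmorph0 !mul0r.
have := Fz [set y | \sum_j ratr (pt a b j 0) * y j 0 = ratr k].
rewrite /= !sum2E !ptE; apply; split=> //.
by exists (pt a b), k.
Qed.

Lemma cF_eq n (F : set 'cV[R]_n) (c : nat) :
  vertex_dens F c -> (forall m, vertex_dens F m -> (c <= m)%N) -> cF F = c.
Proof.
move=> Fc c_min; apply: xget_unique; first by split.
by move=> m [Fm m_min]; apply/eqP; rewrite eqn_leq c_min // m_min.
Qed.

Lemma vertex_dens_gt0 n (F : set 'cV[R]_n) m : vertex_dens F m -> (0 < m)%N.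
Proof. by move=> [e [v [_ _ _ [i ->]]]]; apply: den_gt0. Qed.

Definition rational_pt x := exists r s : rat, x = pt (ratr r) (ratr s).

(** Let x = t (h1, h2) with (h1, h2) primitive.  In a basis of Z^3 extending
    (h1, h2, 0) the vector over x is (g, 0, m), where t = g / m; the vectors
    (0, 1, 1) and (e, 0, q), with g q - m e = 1, complete it to a basis. *)
Lemma cx_rational x : rational_pt x -> cx x = 1%N.
Proof.
move=> [r [s Dx]].
have Fx1 : Fx x = [set x].
  apply/seteqP; split=> [z /FxP zP | z -> ]; last by apply/FxP.
  apply: ptP; rewrite Dx ptE.
    have := zP 1 0 r; rewrite rmorph1 rmorph0 !mul1r !mul0r !addr0 Dx ptE.
    exact.
  have := zP 0 1 s; rewrite rmorph1 rmorph0 !mul1r !mul0r !add0r Dx ptE.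
  exact.
apply: cF_eq => [|m]; last exact: vertex_dens_gt0.
have [t [h1 [h2 [u [v [Dr Ds uv]]]]]] := primitive_direction r s.
have [q [e [q_gt0 Dq]]] := bezout_pos (coprime_num_den t) (denq_gt0 t).
have [] := @regular_triangle (numq t * h1) (numq t * h2) (denq t)
  (- v) u 1 (e * h1) (e * h2) q => //.
  rewrite [X in X \is a _](_ : _ =
    (u * h1 + v * h2) * (numq t * q - denq t * e)); last by ring.
  by rewrite uv Dq.
set w := (fun i => _) => rs dens.
exists 0%N, w; split=> // [|i|].
- exists x, 0; split; first by rewrite mxrank0.
  rewrite Fx1; apply/seteqP; split=> z /=.
    by move=> ->; exists 0 => //; rewrite mul0mx addr0.
  by move=> [? _ <-]; rewrite mul0mx addr0.
- rewrite leqn0 => /eqP i0; rewrite Fx1 /= Dx /w.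
  apply: ptP; rewrite !mxE /tri i0 /= ?Dr ?Ds; congr ratr.
    by rewrite intrM mulrAC divq_num_den.
  by rewrite intrM mulrAC divq_num_den.
- by exists (inord 1); apply/eqP; rewrite -eqz_nat dens /tri inordK.
Qed.

Lemma cx_generic x :
    (forall a b k : rat, ratr a * x 0 0 + ratr b * x 1 0 = ratr k ->
       a = 0 /\ b = 0) ->
  cx x = 1%N.
Proof.
move=> xP; have FxT : Fx x = setT.
  apply/seteqP; split=> // z _; apply/FxP => a b k xk.
  by have [a0 b0] := xP _ _ _ xk; move: xk; rewrite a0 b0 rmorph0 !mul0r.
apply: cF_eq => [|m]; last exact: vertex_dens_gt0.
have [] := @regular_triangle 0 0 1 1 0 1 0 1 1 => //.
set v := (fun i => _) => rs dens.
exists 2%N, v; split=> //; last by exists 0; apply/eqP; rewrite -eqz_nat dens.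
  exists 0, 1%:M; split; first exact: mxrank1.
  rewrite FxT; apply/seteqP; split=> // z _ /=.
  by exists z => //; rewrite add0r mul1mx.
by rewrite FxT.
Qed.

Lemma irrational_lin (a : R) (r s : rat) :
  irrational a -> ratr r + ratr s * a = 0 -> s = 0.
Proof.
move=> irr_a eq0; apply/eqP/contraT => s0; case: irr_a; exists (- r / s) => //.
move/eqP: eq0; rewrite addrC addr_eq0 => /eqP sa.
rewrite rmorphM rmorphN fmorphV /= -sa mulrC mulKf //.
by rewrite fmorph_eq0.
Qed.

(** The matrix with rows (h1, h2) and (v, -u) is unimodular; this is its
    inverse at work. *)
Lemma coordE (h1 h2 u v : int) x : u * h1 + v * h2 = 1 ->
  let s := h1%:~R * x 0 0 + h2%:~R * x 1 0 in
  let a := v%:~R * x 0 0 - u%:~R * x 1 0 in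
  x 0 0 = u%:~R * s + h2%:~R * a /\ x 1 0 = v%:~R * s - h1%:~R * a.
Proof.
move=> uv /=.
have uvR : u%:~R * h1%:~R + v%:~R * h2%:~R = 1 :> R.
  by rewrite -!intrM -intrD uv.
split.
  by transitivity ((u%:~R * h1%:~R + v%:~R * h2%:~R) * x 0 0);
    [rewrite uvR mul1r | ring].
by transitivity ((u%:~R * h1%:~R + v%:~R * h2%:~R) * x 1 0);
  [rewrite uvR mul1r | ring].
Qed.

(** * The integer c_x on a rational line *)

Section Line.
Variables (x : 'cV[R]_2) (h1 h2 u v : int) (r : rat).
Hypothesis uv : u * h1 + v * h2 = 1.
Hypothesis xr : h1%:~R * x 0 0 + h2%:~R * x 1 0 = ratr r.
Hypothesis irr_x : irrational (v%:~R * x 0 0 - u%:~R * x 1 0).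

(** In the coordinates of [coordE], a rational relation satisfied by x has no
    component along the irrational coordinate: it is a multiple of the equation
    of the line. *)
Lemma Fx_line : Fx x = [set z | h1%:~R * z 0 0 + h2%:~R * z 1 0 = ratr r].
Proof.
apply/seteqP; split=> z /=.
  by move/FxP => /(_ h1%:~R h2%:~R r); rewrite !ratr_int; apply.
move=> zr; apply/FxP => a b k xk.
have [x0 x1] := coordE x uv; have [z0 z1] := coordE z uv.
rewrite xr in x0 x1; rewrite zr in z0 z1.
have := irr_x; set xi := (_ * x 0 0 - _) in x0 x1 * => irr_xi.
pose l := (u%:~R * a + v%:~R * b) * r - k; pose m := h2%:~R * a - h1%:~R * b.
have xi0 : ratr l + ratr m * xi = 0.
  rewrite /l /m !(rmorphD, rmorphM, rmorphN) /= -xk x0 x1 !ratr_int; ring.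
have m0 : ratr m = 0 :> R by rewrite (irrational_lin irr_xi xi0) rmorph0.
have l0 : ratr l = 0 :> R by move: xi0; rewrite m0 mul0r addr0.
move: z0 z1; set xi' := (_ * z 0 0 - _) => z0 z1.
apply/eqP; rewrite -subr_eq0 -[X in _ == X]l0 -[X in _ == X]addr0.
rewrite -(mul0r xi') -m0 /l /m !(rmorphD, rmorphM, rmorphN) /= !ratr_int.
by apply/eqP; rewrite z0 z1; ring.
Qed.

Lemma direction_neq0 : pt h2%:~R (- h1%:~R) != 0 :> 'cV[R]_2.
Proof.
apply/eqP => h0; have h2_0 : h2 = 0.
  by apply: (@intr_inj R); rewrite -(ptE (h2%:~R : R) (- h1%:~R)) h0 mxE.
have h1_0 : h1 = 0.
  apply: (@intr_inj R); apply: oppr_inj.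
  by rewrite -(ptE (h2%:~R : R) (- h1%:~R)) h0 mxE oppr0.
by move: uv; rewrite h1_0 h2_0 !mulr0.
Qed.

Lemma Fx_line_dim : has_dim (Fx x) 1.
Proof.
exists (pt (u%:~R * ratr r) (v%:~R * ratr r)), (pt h2%:~R (- h1%:~R)); split.
  by apply/eqP; rewrite eqn_leq rank_leq_col lt0n mxrank_eq0 direction_neq0.
rewrite Fx_line; apply/seteqP; split=> [z zr | _ [c _ <-]] /=.
  have [z0 z1] := coordE z uv; rewrite zr in z0 z1.
  move: z0 z1; set xi' := (_ * z 0 0 - _) => z0 z1.
  exists (const_mx xi') => //.
  apply: ptP; rewrite !mxE big_ord1 !mxE /=; [rewrite z0|rewrite z1]; ring.
have uvR : u%:~R * h1%:~R + v%:~R * h2%:~R = 1 :> R.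
  by rewrite -!intrM -intrD uv.
transitivity ((u%:~R * h1%:~R + v%:~R * h2%:~R) * ratr r : R).
  by rewrite !mxE !big_ord1 !mxE /=; ring.
by rewrite uvR mul1r.
Qed.

(** The line contains x and its translate by (h2, -h1). *)
Lemma Fx_line_dim_gt0 e : has_dim (Fx x) e -> (0 < e)%N.
Proof.
case: e => // -[p [B [_ DF]]]; exfalso; rewrite Fx_line in DF.
have all_p z : h1%:~R * z 0 0 + h2%:~R * z 1 0 = ratr r -> z = p.
  move=> zr; have : [set p + B *m w | w in setT] z by rewrite -DF.
  by move=> [w _ <-]; rewrite thinmx0 mul0mx addr0.
have xp := all_p x xr.
have : x + pt h2%:~R (- h1%:~R) = x.
  by rewrite [RHS]xp; apply: all_p; rewrite !mxE -xr /=; ring.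
by rewrite -[RHS]addr0 => /addrI/eqP; apply/negP/direction_neq0.
Qed.

(** The primitive integer functional that vanishes on the vectors over the line,
    as a row. *)
Definition line_form : 'rV[int]_(2 + 1) :=
  \row_i tri (denq r * h1) (denq r * h2) (- numq r) i.

Lemma line_formE (w : 'cV[int]_(2 + 1)) : (line_form *m w) 0 0 =
  denq r * (h1 * w (lshift 1 0) 0 + h2 * w (lshift 1 1) 0)
  - numq r * w (rshift 2 0) 0.
Proof.
rewrite mxE !big_ord_recl big_ord0 addr0 !mxE /tri /= mulrDr !mulrA mulNr addrA.
by congr (_ + _ - _); congr (_ * _); congr (w _ 0); apply: val_inj.
Qed.

Lemma line_form_vertex (a : 'cV[rat]_2) :
  Fx x (map_mx ratr a) -> (line_form *m homog a) 0 0 = 0.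
Proof.
rewrite Fx_line => ar; have {}ar : h1%:~R * a 0 0 + h2%:~R * a 1 0 = r.
  move: ar; rewrite /= !mxE => ar.
  by apply: (@fmorph_inj _ _ (@ratr R)); rewrite rmorphD !rmorphM /= !ratr_int.
rewrite line_formE; apply: (@intr_inj rat); rewrite intrB !intrM intrD !intrM.
rewrite !homog_val homog_last numqE; set d := (denq r)%:~R.
by rewrite -ar -pmulrn; ring.
Qed.

Lemma line_form_onto : exists w : 'cV[int]_(2 + 1), (line_form *m w) 0 0 = 1.
Proof.
have [t [k [_ tk]]] := bezout_pos (coprime_num_den r) (denq_gt0 r).
exists (\col_i tri (- k * u) (- k * v) (- t) i).
rewrite line_formE !mxE /tri /= -tk -[in RHS](mulr1 (denq r)) -uv; ring.
Qed.

(** A functional that is onto Z and vanishes on two of the three vectors of a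
    basis is invertible on the remaining one. *)
Lemma line_form_last (w : 'I_3 -> 'cV[rat]_2) : regular_simplex w ->
  (forall i : 'I_3, (i <= 1)%N -> Fx x (map_mx ratr (w i))) ->
  let k := (line_form *m homog (w ord_max)) 0 0 in k = 1 \/ k = -1.
Proof.
move=> [b [[b_gen _] [f injf bf]]] wF /=.
have [w1 w1E] := line_form_onto.
have [a Da] := (b_gen w1).1 I.
have fbij : bijective f by apply: injF_bij.
have : (line_form *m homog (w ord_max)) 0 0 * a (f ord_max) = 1.
  rewrite -w1E Da mulmx_sumr summxE (reindex f) /=; last exact: onW_bij.
  rewrite (bigD1 ord_max) //= big1 ?addr0 => [|i i_max].
    by rewrite bf -scaler_int -scalemxAr [RHS]mxE mulrC intz.
  rewrite bf -scaler_int -scalemxAr [LHS]mxE line_form_vertex ?mulr0 //.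
  by apply: wF; move: i_max; case: i => [[|[|[|]]]].
set k := (_ *m _) 0 0 => ka1.
have /eqP := congr1 absz ka1.
by rewrite abszM muln_eq1 => /andP[/eqP k1 _]; lia.
Qed.

Section Minimum.
Variables (c : nat) (s e : int).
Hypothesis c_gt0 : (0 < c)%N.
Hypothesis c_min : c = 1%N \/ (2 * c%:Z < denq r).
Hypothesis ce : denq r * s - numq r * c = e.
Hypothesis e1 : e = 1 \/ e = -1.

(** The first two vertices have homogeneous vectors (p u, p v, d) and
    (p u + h2, p v - h1, d), a basis of the kernel of [line_form].  The third
    one, (s u, s v, c), has value e under [line_form]. *)
Lemma vertex_dens_line : vertex_dens (Fx x) c.
Proof.
have d0 := denq_gt0 r.
have [] := @regular_triangle (numq r * u) (numq r * v) (denq r)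
  (numq r * u + h2) (numq r * v - h1) (denq r) (s * u) (s * v) c => //.
  rewrite [X in X \is a _](_ : _ =
    (u * h1 + v * h2) * (denq r * s - numq r * c%:Z)); last by ring.
  by rewrite uv mul1r ce; case: e1 => ->.
set w := (fun i => _) => rs dens.
exists 1%N, w; split=> //; first exact: Fx_line_dim.
  have lineQ (a b : rat) : h1%:~R * a + h2%:~R * b = r ->
      h1%:~R * ratr a + h2%:~R * ratr b = ratr r :> R.
    by move=> <-; rewrite rmorphD !rmorphM /= !ratr_int.
  have frac (a b : int) : h1 * a + h2 * b = numq r ->
      h1%:~R * (a%:~R / (denq r)%:~R) + h2%:~R * (b%:~R / (denq r)%:~R) = r.
    by move=> ab; rewrite !mulrA -mulrDl -!intrM -intrD ab divq_num_den.
  move=> i i1; rewrite Fx_line /w /= !mxE /= /tri; apply: lineQ.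
  case: i i1 => [[|[|//]] ? _] /=; apply: frac; rewrite -[RHS]mulr1 -uv; ring.
by exists ord_max; apply/eqP; rewrite -eqz_nat dens.
Qed.

(** A vertex on the line has a denominator divisible by d.  The denominator m
    of the other one is congruent to c or - c modulo d, and 0 < m < c would
    make m - c and m + c nonzero and smaller than 2 c < d in absolute value. *)
Lemma vertex_dens_line_ge m : vertex_dens (Fx x) m -> (c <= m)%N.
Proof.
move=> [n [w [dimF rs wF [i ->]]]].
have n_gt0 := Fx_line_dim_gt0 dimF.
have {}wF (j : 'I_3) : (j <= 1)%N -> Fx x (map_mx ratr (w j)).
  by move=> j1; apply: wF; apply: leq_trans n_gt0.
have m_gt0 := den_gt0 (w i).
case: c_min => [-> //|c_lt].
have cpd : coprimez (denq r) (numq r).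
  by rewrite coprimez_sym; exact: coprime_num_den.
have [i1|i2] := leqP i 1%N.
  have := line_form_vertex (wF _ i1); rewrite line_formE homog_last.
  set A := (h1 * _ + _) => /eqP; rewrite subr_eq0 => /eqP DA.
  have : (denq r %| numq r * (den (w i))%:Z)%Z by rewrite -DA dvdz_mulr.
  by rewrite Gauss_dvdzr // => /(dvdn_leq m_gt0) d_le; lia.
have {i2}-> : i = ord_max by case: i i2 {m_gt0} => [[|[|[|]]]] // *; apply: val_inj.
have := line_form_last rs wF; rewrite /= line_formE homog_last.
set A := (h1 * _ + _); set m' := den _ => k1.
have m'_gt0 : (0 < m')%N by apply: den_gt0.
rewrite leqNgt; apply/negP => m'c.
have : (denq r %| m'%:Z - c%:Z)%Z \/ (denq r %| m'%:Z + c%:Z)%Z.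
  rewrite -(Gauss_dvdzr (m'%:Z - c%:Z) cpd) -(Gauss_dvdzr (m'%:Z + c%:Z) cpd).
  have [k1e|k1e] : denq r * A - numq r * m'%:Z = e \/
                   denq r * A - numq r * m'%:Z = - e.
  - by case: e1 => ->; move: k1; lia.
  - left; apply/dvdzP; exists (A - s); rewrite mulrBr mulrBl.
    by move: k1e ce; lia.
  - right; apply/dvdzP; exists (A + s); rewrite mulrDr mulrDl.
    by move: k1e ce; lia.
by case=> /dvdz_le_norm; lia.
Qed.

Lemma cx_line : cx x = c.
Proof. exact: cF_eq vertex_dens_line vertex_dens_line_ge. Qed.

End Minimum.

End Line.

(** * From the rank of G_x to rational relations *)

Lemma Gx_1 x : Gx x 1.
Proof. by exists 1, 0, 0; rewrite !mul0r !addr0. Qed.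

Lemma Gx_fst x : Gx x (x 0 0).
Proof. by exists 0, 1, 0; rewrite mul0r mul1r addr0 add0r. Qed.

Lemma Gx_snd x : Gx x (x 1 0).
Proof. by exists 0, 0, 1; rewrite mul0r mul1r !add0r. Qed.

Lemma ratr_div (m n : int) : ratr (m%:~R / n%:~R) = m%:~R / n%:~R :> R.
Proof. by rewrite fmorph_div /= !ratr_int. Qed.

Lemma ratr_numden (r : rat) : ratr r = (numq r)%:~R / (denq r)%:~R :> R.
Proof. by rewrite -[in LHS](divq_num_den r) ratr_div. Qed.

Lemma rank1_rational x : Zrank (Gx x) = 1%N -> rational_pt x.
Proof.
move=> /Zrank_basis[b [bP _]].
have span (y : R) : Gx x y -> exists c : int, y = b 0 * c%:~R.
  by move=> /bP[c ->]; exists (c 0); rewrite big_ord1 mulrzr.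
have [c c1] := span _ (Gx_1 x).
have [m Dm] := span _ (Gx_fst x); have [n Dn] := span _ (Gx_snd x).
have c0 : c%:~R != 0 :> R.
  by apply: contra_eq_neq c1 => ->; rewrite mulr0 oner_neq0.
have Db : b 0 = c%:~R^-1 by rewrite -[LHS](mulfK c0) -c1 mul1r.
exists (m%:~R / c%:~R), (n%:~R / c%:~R).
by apply: ptP; rewrite ptE ratr_div ?Dm ?Dn Db mulrC.
Qed.

Lemma rational_Gx x (y : R) : rational_pt x -> Gx x y -> exists q, y = ratr q.
Proof.
move=> [r [s ->]] [i [j [k ->]]]; rewrite !ptE.
exists (i%:~R + j%:~R * r + k%:~R * s).
by rewrite !rmorphD !rmorphM /= !ratr_int.
Qed.

(** Any two rational numbers are linearly dependent over Z. *)
Lemma rank2_irrational x : Zrank (Gx x) = 2%N -> ~ rational_pt x.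
Proof.
move=> /Zrank_basis[b bG] xQ; have [_ bfree] := bG.
have bQ i : exists q, b i = ratr q.
  by apply: rational_Gx xQ _; apply: Zbasis_mem bG.
have [p Dp] := bQ 0; have [q Dq] := bQ 1.
have rel (m n : int) : p * m%:~R + q * n%:~R = 0 -> m = 0 /\ n = 0.
  move=> pq0; have /bfree c0 : \sum_i b i *~ (if i == 0 then m else n) = 0.
    rewrite sum2E /= Dp Dq -[_ *~ m]mulrzr -[_ *~ n]mulrzr -(ratr_int _ m) -(ratr_int _ n).
    by rewrite -!rmorphM -rmorphD pq0 rmorph0.
  by split; [exact: c0 0 | exact: c0 1].
have /rel[n0 m0] :
    p * (numq q * denq p)%:~R + q * (- (numq p * denq q))%:~R = 0.
  by rewrite intrN !intrM !numqE; ring.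
have q0 : q = 0.
  apply/eqP; rewrite -numq_eq0.
  by move/eqP: n0; rewrite mulf_eq0 (negPf (denq_neq0 _)) orbF.
have /rel[_ /eqP] : p * 0%:~R + q * 1%:~R = 0 by rewrite q0 mulr0 mul0r addr0.
by rewrite oner_eq0.
Qed.

(** The coordinates of 1, x_1 and x_2 in a basis of G_x form three vectors of
    Z^2, and the 2 x 2 minors give the relation between them.  If both minors
    involving 1 vanished, then the vectors of x_1 and x_2 would be proportional
    to that of 1, and x would be rational. *)
Lemma rank2_relation x : Zrank (Gx x) = 2%N ->
  exists m n k : int, (m != 0) || (n != 0) /\
    m%:~R * x 0 0 + n%:~R * x 1 0 = k%:~R.
Proof.
move=> rk2; have := rank2_irrational rk2.
move: rk2 => /Zrank_basis[b [bP _]] irr_x.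
have span (y : R) : Gx x y -> exists c d : int, y = b 0 * c%:~R + b 1 * d%:~R.
  by move=> /bP[c ->]; exists (c 0), (c 1); rewrite sum2E !mulrzr.
have [m0 [m1 m_1]] := span _ (Gx_1 x).
have [p0 [p1 px]] := span _ (Gx_fst x); have [q0 [q1 qx]] := span _ (Gx_snd x).
exists (q0 * m1 - q1 * m0), (m0 * p1 - m1 * p0), (p1 * q0 - p0 * q1).
have Dm (k : R) : k = k * (b 0 * m0%:~R + b 1 * m1%:~R) by rewrite -m_1 mulr1.
split; last by rewrite px qx [RHS]Dm !intrB !intrM; ring.
apply: contra_notT irr_x; rewrite negb_or !negbK !subr_eq0.
move=> /andP[/eqP/(congr1 (intr : int -> R)) qm /eqP/(congr1 (intr : int -> R)) mp].
rewrite !intrM in qm mp.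
have m0x : m0%:~R * x 0 0 = p0%:~R.
  by rewrite px [RHS]Dm mulrDr mulrCA [_ * (b 1 * _)]mulrCA mp; ring.
have m1x : m1%:~R * x 0 0 = p1%:~R.
  by rewrite px [RHS]Dm mulrDr mulrCA -mp; ring.
have m0y : m0%:~R * x 1 0 = q0%:~R.
  by rewrite qx [RHS]Dm mulrDr [_ * (b 1 * _)]mulrCA [_%:~R * q1%:~R]mulrC -qm; ring.
have m1y : m1%:~R * x 1 0 = q1%:~R.
  by rewrite qx [RHS]Dm mulrDr mulrCA [_%:~R * q0%:~R]mulrC qm; ring.
have solve (m p q : int) : m != 0 -> m%:~R * x 0 0 = p%:~R ->
    m%:~R * x 1 0 = q%:~R -> rational_pt x.
  rewrite -(intr_eq0 R) => nz Dp Dq; exists (p%:~R / m%:~R), (q%:~R / m%:~R).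
  by apply: ptP; rewrite ptE ratr_div -?Dp -?Dq mulrC mulKf.
have [m00|m00] := eqVneq m0 0; last exact: solve m0x m0y.
have [m10|m10] := eqVneq m1 0; last exact: solve m1x m1y.
by move/eqP: m_1; rewrite m00 m10 !mulr0 addr0 oner_eq0.
Qed.

Lemma rank3_generic x : Zrank (Gx x) = 3%N ->
  forall a b k : rat, ratr a * x 0 0 + ratr b * x 1 0 = ratr k ->
  a = 0 /\ b = 0.
Proof.
move=> /Zrank_basis[b bG].
pose g (i : 'I_3) : R := tri 1 (x 0 0) (x 1 0) i.
have gP v : Gx x v <-> exists c : 'I_3 -> int, v = \sum_i g i *~ c i.
  split=> [[m [n [p ->]]]|[c ->]].
    exists (tri m n p).
    by rewrite !big_ord_recl big_ord0 addr0 /g /tri /= addrA !mulrzl.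
  exists (c 0), (c 1), (c ord_max).
  rewrite !big_ord_recl big_ord0 addr0 /g /tri /= addrA !mulrzl.
  by congr (_ *~ c _ + _ *~ c _ + _ *~ c _); apply: val_inj.
move=> r s k rsk.
(* The relation multiplied by the three denominators. *)
pose c := tri (- (numq k * denq r * denq s))
  (numq r * denq s * denq k) (numq s * denq r * denq k) : 'I_3 -> int.
have gc0 : \sum_i g i *~ c i = 0.
  have gcE : \sum_i g i *~ c i =
      (- (numq k * denq r * denq s))%:~R + (numq r * denq s * denq k)%:~R * x 0 0
      + (numq s * denq r * denq k)%:~R * x 1 0.
    rewrite !big_ord_recl big_ord0 addr0 addrA /g /c /tri /=.
    by rewrite !mulrzl.
  rewrite gcE -!(ratr_int R) intrN !intrM !numqE.
  by rewrite !(rmorphN, rmorphM) /= -rsk; ring.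
have c0 := generators_free gP bG gc0.
have := c0 1; have := c0 ord_max; rewrite /c /tri /=.
move=> /eqP; rewrite !mulf_eq0 !(negPf (denq_neq0 _)) !orbF numq_eq0 => /eqP s0.
move=> /eqP; rewrite !mulf_eq0 !(negPf (denq_neq0 _)) !orbF numq_eq0 => /eqP r0.
by [].
Qed.

(** * Normal forms and orbits *)

(** The point x lies in the orbit of (a, r): (h1, h2) is the primitive normal
    vector of its rational line, and (v, -u) completes it to a unimodular
    matrix. *)
Definition normal_form x (a : R) (r : rat) := irrational a /\
  exists h1 h2 u v : int, [/\ u * h1 + v * h2 = 1,
    h1%:~R * x 0 0 + h2%:~R * x 1 0 = ratr r
    & v%:~R * x 0 0 - u%:~R * x 1 0 = a].

Lemma normal_form_exists x :
  Zrank (Gx x) = 2%N -> exists a r, normal_form x a r.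
Proof.
move=> rk2; have [m [n [k [mn0 mnk]]]] := rank2_relation rk2.
have [t [h1 [h2 [u [v [Dm Dn uv]]]]]] := primitive_direction m%:~R n%:~R.
have t0 : t != 0.
  apply: contraTneq mn0 => t0; rewrite negb_or !negbK.
  by rewrite -!(intr_eq0 rat) Dm Dn t0 !mul0r eqxx.
have tR : ratr t != 0 :> R by rewrite fmorph_eq0.
have xr : h1%:~R * x 0 0 + h2%:~R * x 1 0 = ratr (k%:~R / t).
  apply: (mulfI tR); rewrite -rmorphM /= mulrC [in RHS]mulrC divfK //.
  rewrite ratr_int -mnk -(ratr_int _ m) -(ratr_int _ n) Dm Dn.
  by rewrite !rmorphM /= !ratr_int; ring.
exists (v%:~R * x 0 0 - u%:~R * x 1 0), (k%:~R / t); split; last first.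
  by exists h1, h2, u, v; split.
move=> [q _ /esym Dq]; apply: (rank2_irrational rk2).
have [x0 x1] := coordE x uv; rewrite xr Dq in x0 x1.
exists (u%:~R * (k%:~R / t) + h2%:~R * q), (v%:~R * (k%:~R / t) - h1%:~R * q).
by apply: ptP; rewrite ptE ?x0 ?x1 !(rmorphD, rmorphM, rmorphN) /= !ratr_int.
Qed.

Lemma normal_form_pt (a : R) r :
  irrational a -> normal_form (pt a (ratr r)) a r.
Proof.
move=> irr_a; split=> //; exists 0, 1, 0, 1.
by split; rewrite ?ptE !mul0r mul1r ?subr0 ?add0r.
Qed.

Lemma G2orbitP x (y : 'cV[R]_2) : G2orbit x y <->
  exists a b c d e f : int, [/\ a * d - b * c = 1 \/ a * d - b * c = -1,
    y 0 0 = a%:~R * x 0 0 + b%:~R * x 1 0 + e%:~R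
  & y 1 0 = c%:~R * x 0 0 + d%:~R * x 1 0 + f%:~R].
Proof.
split=> [[U [t [dU ->]]]|[a [b [c [d [e [f [dU y0 y1]]]]]]]].
  exists (U 0 0), (U 0 1), (U 1 0), (U 1 1), (t 0 0), (t 1 0).
  by rewrite -det_mx2 !mxE !sum2E !mxE; split.
exists (\matrix_(i, j) if i == 0 then (if j == 0 then a else b)
                        else (if j == 0 then c else d)), (pt e f).
rewrite det_mx2 !mxE; split=> //.
by apply: ptP; rewrite mxE mxE sum2E !mxE.
Qed.

Lemma normal_form_orbit x a r : normal_form x a r -> G2orbit x (pt a (ratr r)).
Proof.
move=> [_ [h1 [h2 [u [v [uv <- <-]]]]]].
apply/G2orbitP; exists v, (- u), h1, h2, 0, 0; rewrite !ptE.
by split; [left; rewrite -[RHS]uv | rewrite intrN | ]; ring.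
Qed.

Lemma G2orbit_sym x (y : 'cV[R]_2) : G2orbit x y -> G2orbit y x.
Proof.
move=> /G2orbitP[a [b [c [d [e [f [dU y0 y1]]]]]]]; apply/G2orbitP.
pose D := a * d - b * c.
have DD : D%:~R * D%:~R = 1 :> R by case: dU; rewrite /D => ->; rewrite -intrM.
exists (D * d), (- D * b), (- D * c), (D * a),
  (D * (b * f - d * e)), (D * (c * e - a * f)); split.
- case: dU => dU; [left|right].
    by rewrite -[RHS]dU [D]dU; ring.
  by rewrite -[RHS]dU [D]dU; ring.
- transitivity (D%:~R * D%:~R * x 0 0); first by rewrite DD mul1r.
  by rewrite y0 y1 /D !(intrB, intrM, intrN); ring.
- transitivity (D%:~R * D%:~R * x 1 0); first by rewrite DD mul1r.
  by rewrite y0 y1 /D !(intrB, intrM, intrN); ring.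
Qed.

Lemma G2orbit_trans x (y z : 'cV[R]_2) :
  G2orbit x y -> G2orbit y z -> G2orbit x z.
Proof.
move=> [U [t [dU ->]]] [W [s [dW ->]]].
exists (W *m U), (W *m t + s); split.
  by rewrite det_mulmx; case: dU => ->; case: dW => ->; [left|right|right|left].
by rewrite map_mxD !map_mxM mulmxDr addrA mulmxA.
Qed.

Lemma G2orbit_refl x : G2orbit x x.
Proof.
apply/G2orbitP; exists 1, 0, 0, 1, 0, 0; split; first by left.
  by rewrite mul1r mul0r !addr0.
by rewrite mul1r mul0r add0r addr0.
Qed.

Lemma Gx_orbit x (y : 'cV[R]_2) : G2orbit x y -> Gx y = Gx x.
Proof.
have sub x1 (y1 : 'cV[R]_2) : G2orbit x1 y1 -> Gx y1 `<=` Gx x1.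
  move=> /G2orbitP[a [b [c [d [e [f [_ y10 y11]]]]]]] _ [i [j [k ->]]].
  exists (i + j * e + k * f), (j * a + k * c), (j * b + k * d).
  by rewrite y10 y11 !intrD !intrM; ring.
by move=> xy; apply/seteqP; split; apply: sub => //; apply: G2orbit_sym.
Qed.

(** With p q - d s = 1 one has 1/d = q (p/d) - s, so the group generated by 1
    and p/d is Z (1/d). *)
Lemma Gx_normal_form x a r : normal_form x a r -> Gx x =
  [set g | exists i j : int, g = i%:~R * a + j%:~R / (denq r)%:~R].
Proof.
move=> nf; have -> := esym (Gx_orbit (normal_form_orbit nf)).
have dR : (denq r)%:~R != 0 :> R by rewrite intr_eq0 denq_neq0.
apply/seteqP; split=> [_ [k [i [j ->]]]|_ [i [j ->]]] /=.
  rewrite !ptE ratr_numden; exists i, (k * denq r + j * numq r).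
  by rewrite intrD !intrM; field.
have [q [s [_ qs]]] := bezout_pos (coprime_num_den r) (denq_gt0 r).
exists (- (j * s)), i, (j * q); rewrite !ptE ratr_numden.
have : (numq r)%:~R * q%:~R - (denq r)%:~R * s%:~R = 1 :> R.
  by rewrite -!intrM -intrB qs.
rewrite intrN !intrM => qsR.
transitivity (i%:~R * a + j%:~R
  * ((numq r)%:~R * q%:~R - (denq r)%:~R * s%:~R) / (denq r)%:~R).
  by rewrite qsR mulr1.
by field.
Qed.

Lemma least_pos_rat_normal_form x a r :
  normal_form x a r -> least_pos_rat (Gx x) (denq r)%:~R^-1.
Proof.
move=> nf; rewrite (Gx_normal_form nf).
have d0 : 0 < (denq r)%:~R :> rat by rewrite ltr0z denq_gt0.
split; first by rewrite invr_gt0.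
  by exists 0, 1; rewrite mul0r add0r mul1r fmorphV /= ratr_int.
move=> q q0 [i [j Dq]].
have i0 : i%:~R = 0 :> rat.
  apply: (irrational_lin (r := j%:~R / (denq r)%:~R - q) nf.1).
  by rewrite rmorphB /= ratr_div ratr_int Dq; ring.
have {}Dq : q = j%:~R / (denq r)%:~R.
  apply: (@fmorph_inj _ _ (@ratr R)); rewrite /= Dq ratr_div.
  by move/eqP: i0; rewrite intr_eq0 => /eqP ->; rewrite mul0r add0r.
move: q0; rewrite Dq pmulr_lgt0 ?invr_gt0 // ltr0z => j0.
apply: ler_peMl; first by rewrite invr_ge0 ltW.
by rewrite -[1]/(1%:~R) ler_int; lia.
Qed.

Lemma normal_form_denq x (y : 'cV[R]_2) a b r s :
  normal_form x a r -> normal_form y b s -> Gx x = Gx y -> denq r = denq s.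
Proof.
move=> nx ny Gxy; rewrite -(denq_inv (denq_gt0 r)) -(denq_inv (denq_gt0 s)).
have [x0 xG x_le] := least_pos_rat_normal_form nx.
have [y0 yG y_le] := least_pos_rat_normal_form ny.
congr (denq _); apply/le_anti/andP; split.
  by apply: x_le => //; rewrite Gxy.
by apply: y_le => //; rewrite -Gxy.
Qed.

Lemma cx_normal_form x a r (c : nat) :
    normal_form x a r -> (0 < c)%N -> c = 1%N \/ 2 * c%:Z < denq r ->
    (denq r %| numq r * c%:Z - 1)%Z \/ (denq r %| numq r * c%:Z + 1)%Z ->
  cx x = c.
Proof.
move=> [irr_a [h1 [h2 [u [v [uv xr xa]]]]]] c0 c_min dvd_pc.
rewrite -xa in irr_a.
have [s [e [ce e1]]] : exists s e : int,
    denq r * s - numq r * c%:Z = e /\ (e = 1 \/ e = -1).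
  case: dvd_pc => /dvdzP[s Ds]; exists s.
    by exists (-1); split; [lia | right].
  by exists 1; split; [lia | left].
exact: (cx_line uv xr irr_a c0 c_min ce e1).
Qed.

(** The representative in [0, d/2] of the inverse of p modulo d, up to sign, is
    c_x, except that for d = 1 this representative is 0 while c_x = 1. *)
Lemma cx_normal_form_bounds x a r : normal_form x a r ->
  [/\ coprime (cx x) `|denq r|, (0 < cx x)%N
    & cx x = 1%N \/ 2 * (cx x)%:Z < denq r].
Proof.
move=> nf; have d0 := denq_gt0 r.
have [q [s [_ qs]]] := bezout_pos (coprime_num_den r) d0.
have cdq : coprimez (denq r) q.
  by apply/coprimezP; exists (- s, numq r); rewrite /= -qs; ring.
have [k [ckd le_kd dvd_k]] := sign_rep d0 cdq.
have dvd_pk : (denq r %| numq r * k%:Z - 1)%Z \/ (denq r %| numq r * k%:Z + 1)%Z.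
  case: dvd_k => /dvdzP[t Dt]; [left|right]; apply/dvdzP.
    by exists (s - numq r * t); rewrite mulrBl -mulrA -Dt -qs; ring.
  by exists (numq r * t - s); rewrite mulrBl -mulrA -Dt -qs; ring.
have [k0|k_gt0] := posnP k.
  have d1 : denq r = 1.
    by move: ckd; rewrite k0 /coprime gcd0n => /eqP; move: d0; lia.
  have -> : cx x = 1%N.
    by apply: (cx_normal_form nf); [|left|left; rewrite d1 dvd1z].
  by split; [rewrite coprime1n | | left].
have k_min : k = 1%N \/ 2 * k%:Z < denq r.
  move: le_kd; rewrite le_eqVlt => /orP[/eqP Dd|]; last by right.
  left; apply/eqP; move: ckd; rewrite -Dd abszM /=.
  by rewrite coprimeMr => /andP[_]; rewrite /coprime gcdnn.
by have -> : cx x = k by apply: (cx_normal_form nf).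
Qed.

(** The shear coefficient j q, with p q = 1 modulo d, produces the summand j/d
    of b up to the integer j e. *)
Lemma G2orbit_pt (a b : R) (r s : rat) (i j : int) :
    denq r = denq s -> i = 1 \/ i = -1 ->
    b = i%:~R * a + j%:~R / (denq r)%:~R ->
    (denq r %| numq s - numq r)%Z \/ (denq r %| numq s + numq r)%Z ->
  G2orbit (pt a (ratr r)) (pt b (ratr s)).
Proof.
move=> drs i1 Db dvd_rs.
have dR : (denq r)%:~R != 0 :> R by rewrite intr_eq0 denq_neq0.
have [m [f [m1 Ds]]] : exists m f : int,
    (m = 1 \/ m = -1) /\ numq s = m * numq r + f * denq r.
  case: dvd_rs => /dvdzP[f Df]; [exists 1, f|exists (-1), f]; split; try lia.
have [q [e [_ qe]]] := bezout_pos (coprime_num_den r) (denq_gt0 r).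
apply/G2orbitP; exists i, (j * q), 0, m, (- (j * e)), f; rewrite !ptE !ratr_numden -drs.
split.
- by rewrite mulr0 subr0; case: i1 => ->; case: m1 => ->; [left|right|right|left].
- rewrite Db.
  transitivity (i%:~R * a + j%:~R
    * ((numq r)%:~R * q%:~R - (denq r)%:~R * e%:~R) / (denq r)%:~R).
    by rewrite -!intrM -intrB qe mulr1.
  by rewrite !(intrN, intrM); field.
- by rewrite Ds intrD !intrM; field.
Qed.

(** As a is irrational, an element of the group that maps (a, r) to (a, s) is
    triangular, with diagonal entries 1 and 1 or -1. *)
Lemma G2orbit_pt_num (a : R) (r s : rat) : irrational a -> denq r = denq s ->
  G2orbit (pt a (ratr r)) (pt a (ratr s)) ->
  (denq r %| numq s - numq r)%Z \/ (denq r %| numq s + numq r)%Z.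
Proof.
move=> irr_a drs /G2orbitP[i [j [k [l [e [f [dU]]]]]]]; rewrite !ptE => Da Ds.
have i1 : i = 1.
  apply/eqP; rewrite -subr_eq0 -(intr_eq0 rat); apply/eqP.
  apply: (irrational_lin (r := j%:~R * r + e%:~R) irr_a).
  rewrite rmorphD rmorphM /= !ratr_int; apply: (addIr a).
  by rewrite [in RHS]Da intrB; ring.
have k0 : k = 0.
  apply/eqP; rewrite -(intr_eq0 rat); apply/eqP.
  apply: (irrational_lin (r := l%:~R * r + f%:~R - s) irr_a).
  by rewrite rmorphB rmorphD rmorphM /= !ratr_int Ds; ring.
have {}Ds : s = l%:~R * r + f%:~R.
  apply: (@fmorph_inj _ _ (@ratr R)).
  by rewrite /= Ds k0 mul0r add0r rmorphD rmorphM /= !ratr_int.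
have {}Ds : numq s = l * numq r + f * denq r.
  apply: (@intr_inj rat); rewrite intrD !intrM !numqE -drs {1}Ds; ring.
rewrite i1 k0 mulr0 subr0 mul1r in dU.
case: dU Ds => -> Ds; [left|right]; apply/dvdzP; exists f; lia.
Qed.

(** Each of a and b is an integer multiple of the other modulo Q; irrationality
    forces the two integers to be inverse to each other. *)
Lemma normal_forms_Gx x (y : 'cV[R]_2) a b r s :
  normal_form x a r -> normal_form y b s -> Gx x = Gx y ->
  exists i j : int, (i = 1 \/ i = -1) /\ b = i%:~R * a + j%:~R / (denq r)%:~R.
Proof.
move=> nx ny Gxy; have drs := normal_form_denq nx ny Gxy.
have gen z c t : normal_form z c t -> Gx z c.
  move=> nz; rewrite (Gx_normal_form nz); exists 1, 0.
  by rewrite mul1r mul0r addr0.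
have : Gx x b by rewrite Gxy; apply: gen ny.
have : Gx y a by rewrite -Gxy; apply: gen nx.
rewrite (Gx_normal_form nx) (Gx_normal_form ny) -drs.
move=> [i' [j' Da]] [i [j Db]]; exists i, j; split=> //.
have /eqP : (i' * i - 1)%:~R = 0 :> rat.
  apply: (irrational_lin (r := (i' * j + j')%:~R / (denq r)%:~R) nx.1).
  rewrite ratr_div ratr_int; apply: (addIr a); rewrite [in RHS]Da Db.
  by rewrite !(intrB, intrD, intrM); ring.
rewrite intr_eq0 subr_eq0 => /eqP ii1; have /eqP := congr1 absz ii1.
by rewrite abszM muln_eq1 => /andP[_ /eqP]; lia.
Qed.

(** The orbits are those of (a, k/d), for k among the representatives of the
    units modulo d up to sign. *)
Lemma rank2_orbits x a r : Zrank (Gx x) = 2%N -> normal_form x a r ->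
  union_of_orbits (maxn 1 (totient `|denq r|)./2)
    [set y : 'cV[R]_2 | Gx y = Gx x].
Proof.
move=> rk2 nx; set d := `|denq r|%N.
have d0 : (0 < d)%N by rewrite absz_gt0 denq_neq0.
have dE : denq r = d by rewrite /d gtz0_abs ?denq_gt0.
rewrite -size_sign_reps //; set ks := sign_reps d.
pose q (k : nat) : rat := k%:Z%:~R / d%:Z%:~R.
have denq_q k : coprime k d -> denq (q k) = d.
  by move=> ckd; rewrite coprimeq_den //; case: (d) d0.
have numq_q k : coprime k d -> numq (q k) = k.
  by move=> ckd; rewrite coprimeq_num // gtr0_sg ?mul1r.
have ksP (i : 'I_(size ks)) : coprime (nth 0%N ks i) d /\ (2 * nth 0%N ks i <= d)%N.
  have : nth 0%N ks i \in ks by rewrite mem_nth.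
  by rewrite mem_filter => /andP[/andP[]].
exists (fun i => G2orbit (pt a (ratr (q (nth 0%N ks i))))); split.
- move=> i j Oij; apply/val_inj/eqP => /=.
  have [ci le_i] := ksP i; have [cj le_j] := ksP j.
  rewrite -(nth_uniq 0%N (ltn_ord i) (ltn_ord j)); last first.
    by rewrite filter_uniq ?iota_uniq.
  have : G2orbit (pt a (ratr (q (nth 0%N ks i)))) (pt a (ratr (q (nth 0%N ks j)))).
    by rewrite Oij; apply: G2orbit_refl.
  move=> /(G2orbit_pt_num nx.1); rewrite !denq_q // !numq_q //.
  move: (nth _ _ i) (nth _ _ j) le_i le_j {ci cj Oij} => k l le_k le_l.
  by move=> /(_ erefl)[] /dvdz_le_norm; lia.
- by move=> i; exists (pt a (ratr (q (nth 0%N ks i)))).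
apply/seteqP; split=> [y /= Gy | y [i _]]; last first.
  have [ci _] := ksP i.
  move=> /Gx_orbit Gy /=; rewrite Gy.
  rewrite (Gx_normal_form (normal_form_pt _ nx.1)) (Gx_normal_form nx).
  by rewrite denq_q // dE.
have [b [s ny]] : exists b s, normal_form y b s.
  by apply: normal_form_exists; rewrite Gy.
have dsr : denq s = denq r by apply: normal_form_denq ny nx Gy.
have [i [j [i1 Da]]] := normal_forms_Gx ny nx Gy.
have cds : coprimez d (numq s).
  by rewrite -dE -dsr coprimez_sym; apply: coprime_num_den.
have [k [ckd le_kd dvd_k]] := sign_rep (d := d) d0 cds.
have kks : k \in ks.
  by rewrite mem_filter mem_iota ckd; lia.
have ik : (index k ks < size ks)%N by rewrite index_mem.
exists (Ordinal ik) => //=; rewrite nth_index //; apply: G2orbit_sym.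
apply: G2orbit_trans (normal_form_orbit ny) _.
apply: (G2orbit_pt _ i1 Da); first by rewrite denq_q // dsr.
rewrite numq_q // dsr dE.
case: dvd_k => dvd_k; [left|by right; rewrite addrC].
by rewrite -opprB rpredN.
Qed.

End Points.

Theorem corollary6p3 (R : realType) (x : 'cV[R]_2) :
  (* (i) *)
  (Zrank (Gx x) = 1%N \/ Zrank (Gx x) = 3%N -> cx x = 1%N) /\
  (Zrank (Gx x) = 2%N ->
   exists q : rat, least_pos_rat (Gx x) q /\
   let d := `|denq q|%N in
   (* (ii) *)
   [/\ ((d <= 4)%N -> cx x = 1%N),
       ((5 <= d)%N -> forall c : nat,
          coprime c d -> (0 < c)%N -> (2 * c < d)%N ->
          exists x' : 'cV[R]_2, Gx x' = Gx x /\ cx x' = c)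
     & union_of_orbits (maxn 1 (totient d)./2)
         [set y : 'cV[R]_2 | Gx y = Gx x]] /\
   (* (iii) *)
   ((5 <= d)%N -> [/\ coprime (cx x) d, (0 < cx x)%N & (2 * cx x < d)%N])).
Proof.
split=> [[rk1|rk3]|rk2].
- exact: cx_rational (rank1_rational rk1).
- exact: cx_generic (rank3_generic rk3).
have [a [r nx]] := normal_form_exists rk2.
exists (denq r)%:~R^-1; split; first exact: least_pos_rat_normal_form nx.
rewrite denq_inv ?denq_gt0 //=; set d := `|denq r|%N.
have d0 : (0 < d)%N by rewrite absz_gt0 denq_neq0.
have dE : denq r = d by rewrite /d gtz0_abs ?denq_gt0.
have [c_d c0 c_min] := cx_normal_form_bounds nx; rewrite dE /= in c_min.
rewrite -/d in c_d.
split; last by move=> d5; split=> //; lia.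
split; last exact: rank2_orbits rk2 nx.
  by move=> d4; lia.
move=> d5 c ccd c_gt0 c_lt.
(* The numerator of the second coordinate is an inverse of c modulo d. *)
have [p [s [_ ps]]] := bezout_pos (g := c) (m := d) ccd d0.
have cpd : coprime `|p| `|d%:Z|.
  rewrite -[coprime _ _]/(coprimez p d); apply/coprimezP.
  by exists (c%:Z, - s); rewrite /= -ps; ring.
pose q : rat := p%:~R / d%:Z%:~R.
have dq : denq q = d by rewrite coprimeq_den //; case: (d) d0.
have pq : numq q = p by rewrite coprimeq_num // gtr0_sg ?mul1r.
have nq : normal_form (pt a (ratr q)) a q := normal_form_pt q nx.1.
exists (pt a (ratr q)); split.
  by rewrite (Gx_normal_form nq) (Gx_normal_form nx) dq dE.
apply: (cx_normal_form nq) => //; first by right; rewrite dq; lia.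
by left; rewrite dq pq; apply/dvdzP; exists s; rewrite mulrC -ps; ring.
Qed.
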